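(* Suppose that for a given $\bar x$ there exist $k_1,k_2,\ldots,k_q\in\{1,2,\ldots,p\}$ such that $f(\bar x,\zeta_{k_1})=f(\bar x,\zeta_{k_2})=\cdots=f(\bar x,\zeta_{k_q})$. Let $\ell$ be the least index in $\{1,2,\ldots,p\}$ for which $$s_\ell(\bar x)=f(\bar x,\zeta_{k_1})=f(\bar x,\zeta_{k_2})=\cdots=f(\bar x,\zeta_{k_q}).$$ Then the Clarke subdifferential of $s_\ell$ at $\bar x$ satisfies $$\partial s_\ell(\bar x)\subseteq \operatorname{conv}\{\partial f(\bar x,\zeta_{k_j}) : j\in\mathcal{J}_\ell(\bar x)\},$$ where $\mathcal{J}_\ell(\bar x)=\{j\in\{1,2,\ldots,q\}: f(\bar x,\zeta_{k_j})=s_\ell(\bar x)\}$. Moreover, if each $f(\cdot,\zeta_{k_j})$, $j=1,2,\ldots,q$, is subdifferentially regular at $\bar x$, then $s_\ell$ is also subdifferentially regular at $\bar x$ and the equality $$\partial s_\ell(\bar x)=\operatorname{conv}\{\partial f(\bar x,\zeta_{k_j}) : j\in\mathcal{J}_\ell(\bar x)\}$$ holds.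
   Context: Setting: $\Omega=\{\zeta_1,\ldots,\zeta_p\}\subseteq\mathbb{R}^m$ is a finite (ordered) uncertainty set, $\mathcal{X}\subseteq\mathbb{R}^n$ is a compact feasible set, $\bar x\in\mathcal{X}$, and $f(x,\zeta)\ge0$ for all $x\in\mathcal{X}$, $\zeta\in\Omega$. The functions $f(\cdot,\zeta_i):\mathbb{R}^n\to\mathbb{R}$, $i=1,\ldots,p$, are locally Lipschitz continuous at $\bar x$ (i.e. Lipschitz on a neighbourhood of $\bar x$). Auxiliary functions $s_1,\ldots,s_p$: for each $x$, recursively for $i=1,\ldots,p$, let $j_i(x)$ be the smallest index among those $j\in\{1,\ldots,p\}\setminus\{j_1(x),\ldots,j_{i-1}(x)\}$ at which $f(x,\zeta_j)$ is maximal over that remaining index set, and put $s_i(x)=f(x,\zeta_{j_i(x)})$. Thus exactly one index is removed at each step, so $s_i(x)$ is the $i$-th largest of the values $f(x,\zeta_1),\ldots,f(x,\zeta_p)$ counted with multiplicity. For $g:\mathbb{R}^n\to\mathbb{R}$ locally Lipschitz at $\bar x$, the Clarke generalized directional derivative is $g^\circ(\bar x;d)=\limsup_{x\to\bar x,\;t\downarrow0}\frac{g(x+td)-g(x)}{t}$, and the Clarke subdifferential is $\partial g(\bar x)=\{\eta\in\mathbb{R}^n: g^\circ(\bar x;d)\ge\eta^\top d\ \text{for all } d\in\mathbb{R}^n\}$. The function $g$ is subdifferentially regular at $\bar x$ if it is locally Lipschitz continuous at $\bar x$, the usual (one-sided) directional derivative $g'(\bar x;d)$ exists for all $d\in\mathbb{R}^n$,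 and $g'(\bar x;d)=g^\circ(\bar x;d)$ for all $d$. $\partial f(\bar x,\zeta)$ denotes the Clarke subdifferential of $f(\cdot,\zeta)$ at $\bar x$, and $\operatorname{conv}\{A_j: j\in J\}$ denotes the convex hull of $\bigcup_{j\in J}A_j$.
   Formalization: The indices k_1,…,k_q are assumed to include every index i with f(x̄,ζ_i) equal to the common value; for an arbitrary tied sub-list the claim fails (f(x,ζ_1)=1+x, f(x,ζ_2)=1−x, x̄=0, q=1, k_1=1). *)

(* Defs.v *)
From HB Require Import structures.
From mathcomp Require Import all_boot all_order all_algebra.
From mathcomp Require Import all_classical all_reals all_analysis.

Set Implicit Arguments.
Unset Strict Implicit.
Unset Printing Implicit Defensive.

Import Order.TTheory GRing.Theory Num.Theory.
Import numFieldNormedType.Exports.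

Local Open Scope classical_set_scope.
Local Open Scope ring_scope.

(* Points of R^n are row vectors 'rV[R]_n. The library norm on them is the
   max norm; it is equivalent to the Euclidean one, so local Lipschitz
   continuity and the topology are unaffected. *)

Section ordered_values.
Variables (R : realType) (p : nat).
Implicit Types (v : 'I_p -> R) (A : {set 'I_p}).

Definition maximizers v A : {set 'I_p} :=
  [set j in A | [forall i in A, v i <= v j]]%SET.

(* smallest index at which v is maximal over A; None iff A is empty *)
Definition first_maximizer v A : option 'I_p :=
  [pick j in maximizers v A | [forall i in maximizers v A, (j <= i)%N]].

Fixpoint remaining v (k : nat) : {set 'I_p} :=
  if k is k'.+1 then
    if first_maximizer v (remaining v k') is Some j
    then (remaining v k' :\ j)%SET else remaining v k'
  else [set: 'I_p]%SET.

(* Indices are 0-based. Before step i < p exactly p - i > 0 indices remain, so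
   the default value of odflt is never used. *)
Definition order_index v (i : 'I_p) : 'I_p :=
  odflt i (first_maximizer v (remaining v i)).

End ordered_values.

Definition ordered_value (R : realType) (n m p : nat)
    (f : 'rV[R]_n -> 'rV[R]_m -> R) (zeta : 'I_p -> 'rV[R]_m)
    (i : 'I_p) (x : 'rV[R]_n) : R :=
  f x (zeta (order_index (fun j => f x (zeta j)) i)).

Section clarke.
Variables (R : realType) (n : nat).
Implicit Types (g : 'rV[R]_n -> R) (x d eta : 'rV[R]_n).

Definition locally_lipschitz_at g x : Prop :=
  exists2 U, nbhs x U & [lipschitz g y | y in U].

Definition diff_quotient g x d (t : R) : R := (g (x + t *: d) - g x) / t.

(* The limsup is taken in \bar R, where it always exists; it is finite when g
   is locally Lipschitz at x. The base point y ranges over full neighbourhoods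
   of x, y = x included. *)
Definition clarke_dderiv g x d : \bar R :=
  limf_esup (fun yt : 'rV[R]_n * R => (diff_quotient g yt.1 d yt.2)%:E)
    (filter_prod (nbhs x) (0 : R)^'+).

Definition clarke_subdiff g x : set 'rV[R]_n :=
  [set eta | forall d, (((eta *m d^T) 0 0)%:E <= clarke_dderiv g x d)%E].

(* meaningful only if the one-sided limit exists *)
Definition dderiv g x d : R := lim (diff_quotient g x d t @[t --> (0 : R)^'+]).

Definition subdiff_regular g x : Prop :=
  [/\ locally_lipschitz_at g x,
      forall d, cvg (diff_quotient g x d t @[t --> (0 : R)^'+]) &
      forall d, (dderiv g x d)%:E = clarke_dderiv g x d].

Definition conv_hull (A : set 'rV[R]_n) : set 'rV[R]_n :=
  smallest (@convex_set R 'rV[R]_n) A.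

End clarke.

(* Main.v *)
Require Import Defs.
From HB Require Import structures.
From mathcomp Require Import all_boot all_order all_algebra.
From mathcomp Require Import all_classical all_reals all_analysis.
From mathcomp Require Import zify ring lra.
Set Implicit Arguments.
Unset Strict Implicit.
Unset Printing Implicit Defensive.
Import Order.TTheory GRing.Theory Num.Theory.
Import numFieldNormedType.Exports.
Local Open Scope classical_set_scope.
Local Open Scope ring_scope.

(** Let c be the common value of the f(xbar, zeta_(k_j)), and call an index
    upper when its value at xbar exceeds c. Being the least position at which
    the ordered values reach c, l is the number of upper indices
    ([least_index_card]). By continuity the upper indices still dominate all
    the others near xbar, so the first l steps of the selection remove exactly
    them, and step l returns the maximum over the rest. That maximum is taken
    at some k_j, because the indices with a value below c stay below. Hence
    s_l is, near xbar, the pointwise maximum of the f(., zeta_(k_j)), all of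
    which are active at xbar ([ordered_value_near_max]). What remains is the
    Clarke calculus of a finite maximum g = max_i h_i with every h_i active
    at x.

    Upper estimate. If h_i attains the maximum at y + t d, the difference
    quotient of g at (y, t) is at most that of h_i, since h_i(y) <= g(y). So
    the Clarke derivative of g is at most max_i h_i°(x; .)
    ([clarke_max_le]).

    From derivatives to subdifferentials. The functions h_i°(x; .) are finite
    and sublinear. A linear form eta bounded by their maximum is a convex
    combination of linear forms xi_i <= h_i° ([mem_hull_of_le_max]). This is a
    single application of the Hahn-Banach theorem, on the space of families
    (d_i, a_i) in R^n x R with the sublinear function max_i (h_i°(d_i) + a_i):
    eta gives a linear form on the diagonal, the values of its extension on the
    scalar coordinates are the weights of the convex combination, and its
    restrictions to the vector coordinates are the weighted xi_i. The
    separation of a point from the hull and the fact that h_i° is the support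
    function of the subdifferential of h_i are thus obtained together.

    Hahn-Banach itself ([linear_minorant_cone]) is proved by shrinking a
    sublinear function P. Given a convex cone K of pairs (k, r) with
    r <= P k, the function u |-> inf (P (u + k) - r) over K is again sublinear
    and at most P, and forces every linear form below it to be at least r
    at k. Taking for K the ray through (v, P v) makes P odd at v, and
    once this holds on a basis, P is linear.

    Equality in the regular case. All h_i are active at x, so the one-sided
    derivative of g is max_i h_i'(x; d) = max_i h_i°(x; d). It is at most
    g°(x; d), which the upper estimate bounds by the same maximum. So g is
    regular, each subdifferential of an h_i lies in that of g, and the latter
    is convex. *)

(** * Selection of the ordered values *)

Section order_selection.
Variables (R : realType) (p : nat).
Implicit Types (v : 'I_p -> R) (A : {set 'I_p}).

Lemma first_maximizer_spec v A : A != finset.set0 ->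
  exists2 j, first_maximizer v A = Some j &
    j \in A /\ (forall i, i \in A -> v i <= v j).
Proof.
case/set0Pn => i0 i0A; rewrite /first_maximizer; case: pickP => [j|noj].
  by case/andP; rewrite inE => /andP[jA /forall_inP jmax] _; exists j.
pose j0 := [arg max_(i > i0 in A) v i]%O.
have j0M : j0 \in maximizers v A.
  rewrite /j0; case: arg_maxP => // j jA jmax; rewrite inE jA; exact/forall_inP.
pose j1 := [arg min_(j < j0 in maximizers v A) (j : nat)]%N.
have := noj j1; rewrite /j1; case: arg_minnP => //= j jM jmin.
by rewrite jM /= => /negP[]; exact/forall_inP.
Qed.

Lemma card_remaining v k : (k <= p)%N -> #|remaining v k| = (p - k)%N.
Proof.
elim: k => [_|k IHk lekp] /=; first by rewrite cardsT card_ord subn0.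
have cardk := IHk (ltnW lekp).
have [|j -> [jk _]] := @first_maximizer_spec v (remaining v k).
  by rewrite -card_gt0 cardk subn_gt0.
by rewrite subnS -cardk [in RHS](cardsD1 j) jk.
Qed.

(** A set A whose values dominate all others cannot be exhausted in fewer than
    #|A| steps, so each of these steps selects within A. *)
Lemma first_maximizer_upper v A k :
    (forall i j, i \in A -> j \notin A -> v j < v i) -> (k < #|A|)%N ->
  exists2 j, first_maximizer v (remaining v k) = Some j & j \in A.
Proof.
move=> Aup ltkA; have leAp : (#|A| <= p)%N.
  by rewrite -[leqRHS]card_ord max_card.
have cardk : #|remaining v k| = (p - k)%N by apply: card_remaining; lia.
have [i ik iA] : exists2 i, i \in remaining v k & i \in A.
  apply/exists_inP; apply: contraT; rewrite negb_exists_in => /forall_inP noA.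
  have : (#|remaining v k| <= #|(~: A)%SET|)%N.
    by apply: subset_leq_card; apply/fintype.subsetP => i ik; rewrite inE noA.
  by have := cardsC A; rewrite card_ord cardk; lia.
have [|j -> [jk jmax]] := @first_maximizer_spec v (remaining v k).
  by apply/set0Pn; exists i.
exists j => //; apply: contraT => jA.
by have := Aup _ _ iA jA; rewrite ltNge jmax.
Qed.

Lemma order_index_upper v A (i : 'I_p) :
    (forall i j, i \in A -> j \notin A -> v j < v i) -> (i < #|A|)%N ->
  order_index v i \in A.
Proof.
by move=> Aup /(first_maximizer_upper Aup)[j jE jA]; rewrite /order_index jE.
Qed.

(** No step before the #|A|-th removes an index outside A, so ~: A is still
    there; a comparison of cardinals shows that nothing else is. *)
Lemma remaining_upper v A :
    (forall i j, i \in A -> j \notin A -> v j < v i) ->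
  remaining v #|A| = (~: A)%SET.
Proof.
move=> Aup; have sub k : (k <= #|A|)%N -> (~: A \subset remaining v k)%SET.
  elim: k => [_|k IHk ltkA] /=; first exact: finset.subsetT.
  have [j -> jA] := first_maximizer_upper Aup ltkA.
  by rewrite subsetD1 IHk ?inE ?jA // ltnW.
apply/esym/eqP; rewrite eqEcard sub //=.
have cardA := cardsC A; rewrite card_ord in cardA.
have leAp: (#|A| <= p)%N by rewrite -[leqRHS]card_ord max_card.
by rewrite card_remaining ?leq_subLR ?cardA.
Qed.

Lemma order_index_card v A (i : 'I_p) :
    (forall i j, i \in A -> j \notin A -> v j < v i) -> i = #|A| :> nat ->
  order_index v i \notin A /\
  (forall j, j \notin A -> v j <= v (order_index v i)).
Proof.
move=> Aup iE; rewrite /order_index iE remaining_upper //.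
have [|j -> [jA jmax]] := @first_maximizer_spec v (~: A)%SET.
  by rewrite -card_gt0 -(ltn_add2l #|A|) cardsC card_ord addn0 -iE.
by split=> [|k kA]; [move: jA; rewrite inE|apply: jmax; rewrite inE].
Qed.

End order_selection.

(** * Sublinear functions and the Hahn-Banach theorem *)

Section sublinear.
Variable R : realType.

(** The inequality for scalars also covers a = 0, which gives P 0 <= 0; the
    equality P (a *: u) = a * P u follows by rescaling with a^-1. *)
Definition sublinear (V : lmodType R) (P : V -> R) :=
  (forall u v, P (u + v) <= P u + P v) /\
  (forall a u, 0 <= a -> P (a *: u) <= a * P u).

Section sublinear_lmod.
Variable V : lmodType R.
Implicit Types (P Q : V -> R) (u v : V).

Lemma sublinear0 P : sublinear P -> P 0 = 0.
Proof.
move=> [PD PZ]; have := PZ 0 0 (lexx 0); have := PD 0 0.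
by rewrite scale0r mul0r addr0; lra.
Qed.

Lemma sublinear_ge_opp P u : sublinear P -> - P (- u) <= P u.
Proof.
move=> sP; have [PD _] := sP; have := PD u (- u).
by rewrite subrr sublinear0 //; lra.
Qed.

(** The new function is the infimal convolution of P with K. It is finite
    because r <= P k bounds P (u + k) - r below by - P (- u), whatever
    (k, r). Evaluated at - k with the pair (k, r) itself, it is at most - r. *)
Lemma sublinear_minorant_cone P (K : V -> R -> Prop) : sublinear P ->
    K 0 0 ->
    (forall k r k' r', K k r -> K k' r' -> K (k + k') (r + r')) ->
    (forall a k r, 0 <= a -> K k r -> K (a *: k) (a * r)) ->
    (forall k r, K k r -> r <= P k) ->
  exists Q, [/\ sublinear Q, forall u, Q u <= P u &
                forall k r, K k r -> Q (- k) <= - r].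
Proof.
move=> sP K0 KD KZ KP; have [PD PZ] := sP.
pose S u := [set s | exists k r, K k r /\ s = P (u + k) - r].
pose Q u := inf (S u).
have SlB u : lbound (S u) (- P (- u)).
  move=> _ [k [r [Kkr ->]]]; have := PD (u + k) (- u); have := KP _ _ Kkr.
  by rewrite addrAC subrr add0r; lra.
have Qle u k r : K k r -> Q u <= P (u + k) - r.
  by move=> Kkr; apply: ge_inf; [exists (- P (- u))|exists k, r].
have leQ u c : (forall k r, K k r -> c <= P (u + k) - r) -> c <= Q u.
  move=> cle; apply: lb_le_inf; first by exists (P (u + 0) - 0); exists 0, 0.
  by move=> _ [k [r [Kkr ->]]]; exact: cle.
have QP u : Q u <= P u by have := Qle u _ _ K0; rewrite addr0 subr0.
exists Q; split => //; last first.
  move=> k r Kkr; have := Qle (- k) _ _ Kkr.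
  by rewrite addNr sublinear0 // add0r.
split=> [u v|a u].
  rewrite -lerBlDr; apply/leQ => k r Kkr; rewrite lerBlDl -lerBlDr.
  apply/leQ => k' r' Kkr'; have := Qle (u + v) _ _ (KD _ _ _ _ Kkr Kkr').
  by rewrite addrACA; have := PD (u + k) (v + k'); lra.
rewrite le_eqVlt => /predU1P[<-|a0].
  by rewrite scale0r mul0r (le_trans (QP 0)) // sublinear0.
rewrite mulrC -ler_pdivrMr //; apply/leQ => k r Kkr.
rewrite ler_pdivrMr //; have := Qle (a *: u) _ _ (KZ _ _ _ (ltW a0) Kkr).
by rewrite -scalerDr; have := PZ a (u + k) (ltW a0); lra.
Qed.

(** Here K is the ray through (v, P v). The bound Q (- v) <= - P v, together
    with Q v <= P v, leaves no room between Q v and - Q (- v). *)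
Lemma sublinear_flat P v : sublinear P ->
  exists Q, [/\ sublinear Q, forall u, Q u <= P u & Q (- v) = - Q v].
Proof.
move=> sP; have [PD PZ] := sP.
pose K k r := exists2 t : R, 0 <= t & k = t *: v /\ r = t * P v.
have [||||Q [sQ QP QK]] := @sublinear_minorant_cone P K sP.
- by exists 0 => //; rewrite scale0r mul0r.
- move=> k r k' r' [t t0 [-> ->]] [s s0 [-> ->]].
  by exists (t + s); rewrite ?addr_ge0 // scalerDl mulrDl.
- move=> a k r a0 [t t0 [-> ->]].
  by exists (a * t); rewrite ?mulr_ge0 // scalerA mulrA.
- move=> k r [t]; rewrite le_eqVlt => /predU1P[<- [-> ->]|t0 [-> ->]].
    by rewrite scale0r mul0r sublinear0.
  rewrite -ler_pdivlMl //.
  have := PZ t^-1 (t *: v); rewrite scalerA mulVf ?gt_eqF // scale1r.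
  by apply; rewrite invr_ge0 ltW.
exists Q; split => //; have [] := QP v.
have /QK : K v (P v) by exists 1; rewrite // scale1r mul1r.
by have := sublinear_ge_opp v sQ; lra.
Qed.

(** Oddness at v survives any further decrease, so that the vectors of a list
    can be treated one after the other. *)
Lemma sublinear_flat_le P Q v : sublinear Q -> (forall u, Q u <= P u) ->
  P (- v) = - P v -> Q (- v) = - Q v.
Proof.
move=> sQ QP Pv; have := QP v; have := QP (- v).
by have := sublinear_ge_opp v sQ; lra.
Qed.

Lemma sublinear_flat_seq P (s : seq V) : sublinear P ->
  exists Q, [/\ sublinear Q, forall u, Q u <= P u &
                forall v, v \in s -> Q (- v) = - Q v].
Proof.
move=> sP; elim: s => [|v s [Q [sQ QP Qs]]]; first by exists P.
have [Q' [sQ' QQ' Q'v]] := sublinear_flat v sQ.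
exists Q'; split => // [u|u]; first exact: le_trans (QQ' u) (QP u).
rewrite inE => /predU1P[->//|us].
exact: sublinear_flat_le QQ' (Qs _ us).
Qed.

(** The vectors at which Q is odd form a subspace on which Q is linear. *)
Section flat_span.
Variable Q : V -> R.
Hypothesis sQ : sublinear Q.

Let flatD u v : Q (- v) = - Q v -> Q (u + v) = Q u + Q v.
Proof.
move=> fv; have [QD _] := sQ; have := QD u v; have := QD (u + v) (- v).
by rewrite addrK fv; lra.
Qed.

Let flatN u : Q (- u) = - Q u -> Q (- - u) = - Q (- u).
Proof. by move=> fu; rewrite opprK fu opprK. Qed.

Let sublinearZ a u : 0 <= a -> Q (a *: u) = a * Q u.
Proof.
rewrite le_eqVlt => /predU1P[<-|a0]; first by rewrite scale0r mul0r sublinear0.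
have [_ QZ] := sQ; have := QZ _ u (ltW a0).
have := QZ a^-1 (a *: u); rewrite invr_ge0 ltW // => /(_ isT).
by rewrite scalerA mulVf ?gt_eqF // scale1r ler_pdivlMl //; lra.
Qed.

Let flatZ a u : Q (- u) = - Q u -> Q (a *: u) = a * Q u.
Proof.
move=> fu; have [a0|a0] := leP 0 a; first exact: sublinearZ.
have := @sublinearZ (- a) (- u); rewrite oppr_ge0 ltW // => /(_ isT).
by rewrite scalerN scaleNr opprK fu mulrNN.
Qed.

Lemma flat_scalar : (forall u, Q (- u) = - Q u) -> scalar Q.
Proof. by move=> fQ a u v; rewrite flatD // flatZ. Qed.

Lemma flat_sum (I : Type) (s : seq I) (a : I -> R) (b : I -> V) :
  (forall i, Q (- b i) = - Q (b i)) ->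
  Q (- \sum_(i <- s) a i *: b i) = - Q (\sum_(i <- s) a i *: b i).
Proof.
move=> fb; elim: s => [|i s IHs].
  by rewrite big_nil oppr0 sublinear0 // oppr0.
have fZ : Q (- (a i *: b i)) = - Q (a i *: b i).
  by rewrite -scaleNr !flatZ // mulNr.
rewrite big_cons opprD addrC flatD; last exact: flatN.
by rewrite IHs fZ addrC flatD // opprD addrC.
Qed.

End flat_span.
End sublinear_lmod.

Lemma linear_minorant (V : vectType R) (P : V -> R) : sublinear P ->
  exists phi : V -> R, scalar phi /\ forall u, phi u <= P u.
Proof.
move=> sP; have [Q [sQ QP Qb]] := sublinear_flat_seq (vbasis {:V}) sP.
exists Q; split=> //; apply: flat_scalar => // u.
rewrite (coord_vbasis (memvf u)).
apply: flat_sum => // i; exact/Qb/memt_nth.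
Qed.

(** Hahn-Banach in the form of domination on a cone: when K is the graph of a
    linear form on a subspace, phi extends that form, since K then contains
    (- k, - r) along with (k, r). *)
Lemma linear_minorant_cone (V : vectType R) (P : V -> R) (K : V -> R -> Prop) :
    sublinear P -> K 0 0 ->
    (forall k r k' r', K k r -> K k' r' -> K (k + k') (r + r')) ->
    (forall a k r, 0 <= a -> K k r -> K (a *: k) (a * r)) ->
    (forall k r, K k r -> r <= P k) ->
  exists phi : V -> R, [/\ scalar phi, forall u, phi u <= P u &
                           forall k r, K k r -> r <= phi k].
Proof.
move=> sP K0 KD KZ KP.
have [Q [sQ QP QK]] := sublinear_minorant_cone sP K0 KD KZ KP.
have [phi [lphi phiQ]] := linear_minorant sQ; exists phi; split=> //.
  by move=> u; exact: le_trans (phiQ u) (QP u).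
move=> k r Kkr; have := le_trans (phiQ _) (QK _ _ Kkr).
(* packing phi as a linear map gives access to the oddness of phi *)
pose phiL := GRing.isLinear.Build _ _ _ _ phi lphi.
pose phi' : {linear V -> R^o} := HB.pack phi phiL.
by rewrite -[phi _]/(phi' _) raddfN lerN2.
Qed.

End sublinear.

(** * Linear forms below a maximum of sublinear functions *)

Section support_of_max.
Variables (R : realType) (n : nat).
Implicit Types (C : set 'rV[R]_n) (d u v eta : 'rV[R]_n).

Lemma scalar_dot (psi : 'rV[R]_n -> R) : scalar psi ->
  exists xi : 'rV[R]_n, forall d, psi d = (xi *m d^T) 0 0.
Proof.
move=> lpsi.
pose psiL := GRing.isLinear.Build _ _ _ _ psi lpsi.
pose psi' : {linear 'rV[R]_n -> R^o} := HB.pack psi psiL.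
exists (\row_j psi (delta_mx 0 j)) => d.
rewrite -[psi d]/(psi' d) [d in LHS]row_sum_delta linear_sum mxE.
by apply: eq_bigr => j _; rewrite linearZ /= !mxE mulrC.
Qed.

Lemma dotD eta u v :
  (eta *m (u + v)^T) 0 0 = (eta *m u^T) 0 0 + (eta *m v^T) 0 0.
Proof. by rewrite linearD mulmxDr [LHS]mxE. Qed.

Lemma dotZ eta a u : (eta *m (a *: u)^T) 0 0 = a * (eta *m u^T) 0 0.
Proof. by rewrite linearZ -scalemxAr [LHS]mxE. Qed.

Lemma dotN eta u : (eta *m (- u)^T) 0 0 = - (eta *m u^T) 0 0.
Proof. by rewrite linearN mulmxN [LHS]mxE. Qed.

Lemma dot0 eta : (eta *m (0 : 'rV[R]_n)^T) 0 0 = 0.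
Proof. by rewrite linear0 mulmx0 mxE. Qed.

Lemma dot_inj (xi eta : 'rV[R]_n) :
  (forall d, (xi *m d^T) 0 0 = (eta *m d^T) 0 0) -> xi = eta.
Proof.
move=> e; apply/rowP => j; have := e (delta_mx 0 j).
by rewrite !trmx_delta -!colE !mxE.
Qed.

(** The pairs (t, w) with t > 0 and w in t C, together with (0, 0), form a
    convex cone, so a sum can be treated term by term; an index of weight zero,
    whose xi i may lie outside C, contributes (0, 0). *)
Lemma convex_combination (I : finType) (lam : I -> R) (xi : I -> 'rV[R]_n) C :
    @convex_set R 'rV[R]_n C ->
    (forall i, 0 <= lam i) -> \sum_i lam i = 1 ->
    (forall i, 0 < lam i -> C (xi i)) ->
  C (\sum_i lam i *: xi i).
Proof.
move=> cC lam0 lam1 xiC.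
pose K (t : R) (w : 'rV[R]_n) := (t = 0 /\ w = 0) \/ (0 < t /\ C (t^-1 *: w)).
have : K (\sum_i lam i) (\sum_i lam i *: xi i).
  apply: big_ind2 => [|t w t' w'|i _]; first by left.
  - case=> [[-> ->]|[t0 tw]]; first by rewrite !add0r.
    case=> [[-> ->]|[t'0 tw']]; first by rewrite !addr0; right.
    right; split; first exact: addr_gt0.
    have s0 : 0 < t + t' by exact: addr_gt0.
    have k01 : 0 <= t / (t + t') <= 1.
      rewrite divr_ge0 ?(ltW t0) ?(ltW s0) //=.
      by rewrite ler_pdivrMr // mul1r lerDl ltW.
    have [k0 k1] := andP k01.
    have := cC _ _ (Itv01 k0 k1) (mem_set tw) (mem_set tw').
    rewrite inE; congr C.
    rewrite /conv /= !scalerA scalerDr; congr (_ *: _ + _ *: _).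
      by field; rewrite !gt_eqF.
    by rewrite -[LHS]/((1 - t / (t + t')) * t'^-1); field; rewrite !gt_eqF.
  - have := lam0 i; rewrite le_eqVlt => /predU1P[<-|li].
      by left; rewrite scale0r.
    by right; split=> //; rewrite scalerA mulVf ?gt_eqF // scale1r; exact: xiC.
rewrite lam1 => -[[/eqP]|[_]]; first by rewrite oner_eq0.
by rewrite invr1 scale1r.
Qed.

Section decomposition.
Variables (I : finType) (i0 : I) (h : I -> 'rV[R]_n -> R) (eta : 'rV[R]_n).
Hypothesis sh : forall i, sublinear (h i).
Hypothesis eta_le : forall d, exists i, (eta *m d^T) 0 0 <= h i d.

Let W : vectType R := ('rV[R]_n * R^o)%type.
Let V : vectType R := {ffun I -> W}.

(* W is one slot (d_i, a_i), V the space of families of slots. *)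
Let F (z : V) i : R := h i (z i).1 + (z i).2.
Let P (z : V) : R := \big[Order.max/F z i0]_i F z i.

Let P_le z c : (forall i, F z i <= c) -> P z <= c.
Proof. by move=> Fc; apply: bigmax_le. Qed.

Let F_le z i : F z i <= P z.
Proof. exact: le_bigmax. Qed.

Let sublinear_P : sublinear P.
Proof.
split=> [u v|a u a0]; apply: P_le => i.
  apply: le_trans (lerD (F_le u i) (F_le v i)).
  have [hD _] := sh i; rewrite /F !ffunE /= addrACA lerD2r; exact: hD.
apply: le_trans (ler_wpM2l a0 (F_le u i)).
by have [_ hZ] := sh i; rewrite /F !ffunE /= mulrDr lerD2r; exact: hZ.
Qed.

Let h0 i : h i 0 = 0.
Proof. exact: sublinear0. Qed.

Let diag (w : W) : V := [ffun => w].
Let only i (w : W) : V := [ffun j => if j == i then w else 0].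

(** The scalar coordinates homogenize the problem. Testing the extension phi
    on the pair (0, -1) in the slot i shows that the weight lam i is
    nonnegative, and on the constant family (0, 1) that the weights sum to 1.
    On (d, - h i d) in the slot i it gives the bound
    phi (only i (d, 0)) <= lam i * h i d. When lam i = 0, this bound forces the
    linear form of slot i to vanish, so nothing is lost in dividing by the
    positive weights only. *)
Lemma mem_hull_of_le_max : exists (lam : I -> R) (xi : I -> 'rV[R]_n),
  [/\ forall i, 0 <= lam i, \sum_i lam i = 1,
      forall i d, 0 < lam i -> (xi i *m d^T) 0 0 <= h i d &
      eta = \sum_i lam i *: xi i].
Proof.
pose K (z : V) (r : R) :=
  exists w : W, z = diag w /\ r = (eta *m w.1^T) 0 0 + w.2.
have [||||phi [lphi phiP phiK]] := @linear_minorant_cone _ _ P K sublinear_P.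
- exists 0; split; first by apply/ffunP => i; rewrite !ffunE.
  by rewrite /= dot0 addr0.
- move=> k r k' r' [w [-> ->]] [w' [-> ->]]; exists (w + w'); split.
    by apply/ffunP => i; rewrite !ffunE.
  by rewrite /= dotD addrACA.
- move=> a k r a0 [w [-> ->]]; exists (a *: w); split.
    by apply/ffunP => i; rewrite !ffunE.
  by rewrite /= dotZ mulrDr.
- move=> k r [w [-> ->]]; have [i hi] := eta_le w.1.
  by apply: le_trans (F_le _ i); rewrite /F ffunE lerD2r.
pose phiL := GRing.isLinear.Build _ _ _ _ phi lphi.
pose phi' : {linear V -> R^o} := HB.pack phi phiL.
have phiN (u : V) : phi (- u) = - phi u by exact: (raddfN phi').
have phiD (u v : V) : phi (u + v) = phi u + phi v by exact: (raddfD phi').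
have phi_diag w : phi (diag w) = (eta *m w.1^T) 0 0 + w.2.
  have Kw : K (diag w) ((eta *m w.1^T) 0 0 + w.2) by exists w.
  (* the diagonal is a subspace: with - w, the bound becomes an equality *)
  have KNw : K (- diag w) (- ((eta *m w.1^T) 0 0 + w.2)).
    exists (- w); split; first by apply/ffunP => i; rewrite !ffunE.
    by rewrite /= dotN opprD.
  by apply/eqP; rewrite eq_le phiK // andbT -lerN2 -phiN phiK.
have phi_only w : phi (diag w) = \sum_i phi (only i w).
  rewrite -(raddf_sum phi'); congr phi; apply/ffunP => j.
  rewrite sum_ffunE ffunE (bigD1 j) //= big1 ?addr0 ?ffunE ?eqxx // => i.
  by rewrite ffunE eq_sym => /negPf->.
have only_le i d a : phi (only i (d, a)) <= Num.max 0 (h i d + a).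
  apply: le_trans (phiP _) _; apply: P_le => j; rewrite /F ffunE.
  rewrite le_max; case: eqP => [->|_]; first by rewrite lexx orbT.
  by rewrite -[X in X <= 0]/(h j 0 + 0) h0 addr0 lexx.
have onlyP i : scalar (fun w => phi (only i w)).
  move=> a u v; rewrite -lphi; congr phi; apply/ffunP => j; rewrite !ffunE.
  by case: eqP => // _; rewrite scaler0 addr0.
pose lam i := phi (only i (0, 1)).
have phi0a i a : phi (only i (0, a)) = a * lam i.
  pose L := GRing.isLinear.Build _ _ _ _ _ (onlyP i).
  pose L' : {linear W -> R^o} := HB.pack (fun w => phi (only i w)) L.
  have -> : (0, a) = a *: ((0, 1) : W).
    by congr pair; rewrite ?scaler0 //= -[RHS]/(a * 1) mulr1.
  exact: (linearZ_LR L').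
have psiP i : scalar (fun d => phi (only i (d, 0))).
  move=> a u v; rewrite -onlyP; congr (phi (only i _)).
  by congr pair; rewrite /= ?scaler0 ?addr0.
have [xi xiE] : exists xi : I -> 'rV[R]_n,
    forall i d, phi (only i (d, 0)) = (xi i *m d^T) 0 0.
  have /choice[xi xiE] := fun i => scalar_dot (psiP i).
  by exists xi.
have lam_le i d : (xi i *m d^T) 0 0 <= lam i * h i d.
  have := only_le i d (- h i d); rewrite subrr maxxx.
  have -> : only i (d, - h i d) = only i (d, 0) + only i (0, - h i d).
    apply/ffunP => j; rewrite !ffunE; case: eqP => _; last by rewrite addr0.
    by congr pair; rewrite /= ?addr0 ?add0r.
  by rewrite phiD phi0a xiE mulNr subr_le0 mulrC.
exists lam, (fun i => (lam i)^-1 *: xi i).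
have lam0 i : 0 <= lam i.
  have := only_le i 0 (- 1); rewrite phi0a h0 add0r.
  by rewrite max_l ?lerN10 //; lra.
split=> //.
- by rewrite -phi_only phi_diag /= dot0 add0r.
- move=> i d li; rewrite -scalemxAl mxE ler_pdivrMl //; exact: lam_le.
apply: dot_inj => d; have := phi_diag (d, 0); rewrite addr0 /= => <-.
rewrite phi_only mulmx_suml summxE; apply: eq_bigr => i _; rewrite xiE.
congr ((_ *m _) 0 0); rewrite scalerA.
have [li0|li0] := eqVneq (lam i) 0; last by rewrite mulfV // scale1r.
rewrite li0 mul0r scale0r; apply: dot_inj => e; rewrite mul0mx [RHS]mxE.
have := lam_le i e; have := lam_le i (- e).
rewrite dotN li0 !mul0r oppr_le0 => xi_ge xi_le.
by apply/eqP; rewrite eq_le xi_le.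
Qed.

End decomposition.
End support_of_max.

(** * Clarke directional derivatives *)

Section limsup.
Variables (T : choiceType) (X : filteredType T) (R : realType).
Implicit Types (u : X -> R) (F : set_system X).

Lemma limf_esup_leP F {FF : Filter F} u c :
  (limf_esup (fun z => (u z)%:E) F <= c%:E)%E <->
  forall e, 0 < e -> \forall z \near F, u z <= c + e.
Proof.
split=> [uc e e0|uc].
  have : (limf_esup (fun z => (u z)%:E) F < (c + e)%:E)%E.
    by apply: le_lt_trans uc _; rewrite lte_fin ltrDl.
  rewrite limf_esupE => /ereal_inf_lt[_ [V FV <-]] Vce.
  apply: filterS FV => z Vz; rewrite -lee_fin; apply: le_trans (ltW Vce).
  by apply: ereal_sup_ubound; exists z.
apply/lee_addgt0Pr => e e0; rewrite limf_esupE -EFinD.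
apply: ge_ereal_inf; pose V := [set z | u z <= c + e].
exists (ereal_sup [set (u z)%:E | z in V]); first by exists V => //; exact: uc.
by apply: ge_ereal_sup => _ [z /= uz <-]; rewrite lee_fin.
Qed.

Lemma limf_esup_ge F {FF : ProperFilter F} u c :
  (\forall z \near F, c <= u z) ->
  (c%:E <= limf_esup (fun z => (u z)%:E) F)%E.
Proof.
move=> cu; rewrite limf_esupE; apply: le_ereal_inf_tmp => _ [V FV <-].
have [z [Vz cz]] := filter_ex (filterI FV cu).
by apply: le_ereal_sup_tmp; exists (u z)%:E; rewrite ?lee_fin //; exists z.
Qed.

End limsup.

Section clarke_calculus.
Variables (R : realType) (n : nat).
Implicit Types (g : 'rV[R]_n -> R) (x d : 'rV[R]_n).

(** The two variables may range over different neighbourhoods of x; their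
    intersection serves both. *)
Lemma locally_lipschitzP g x : locally_lipschitz_at g x <->
  exists K : R, \forall y \near x & z \near x, `|g y - g z| <= K * `|y - z|.
Proof.
split=> [[U Ux /pinfty_ex_gt0[K K0 gK]]|[K [[U V] [/= Ux Vx] gK]]].
  by exists K; exists (U, U) => // -[y z] /= [Uy Uz]; exact: (gK (y, z)).
exists (U `&` V); first exact: filterI.
exists K; split; first exact: num_real.
move=> L KL [y z] /= [[Uy _] [_ Vz]].
by apply: le_trans (gK (y, z) (conj Uy Vz)) _; rewrite ler_wpM2r // ltW.
Qed.

Lemma locally_lipschitz_cvg g x : locally_lipschitz_at g x ->
  g y @[y --> x] --> g x.
Proof.
case/locally_lipschitzP => K gK.
have gKx : \forall y \near x, `|g x - g y| <= K * `|x - y|.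
  case: gK => -[U V] [/= Ux Vx] gK; apply: filterS Vx => y Vy.
  by apply: (gK (x, y)); split => //=; exact: nbhs_singleton.
apply: (@cvgrPdist_le _ _ _ (nbhs x) _ g (g x)).2 => e e0.
have K1 : 0 < `|K| + 1 by rewrite ltr_wpDl.
have xe : \forall y \near x, `|x - y| <= e / (`|K| + 1).
  have e1 : 0 < e / (`|K| + 1) by rewrite divr_gt0.
  exact: (@cvgr_dist_le _ _ _ (nbhs x) _ id x cvg_id _ e1).
apply: filterS2 gKx xe => y /le_trans gy xy; apply: gy; move: xy.
rewrite ler_pdivlMr // => xy; apply: le_trans xy.
by rewrite mulrC ler_wpM2l // (le_trans (ler_norm K)) // lerDl.
Qed.

(** The filter of the limsup that defines the Clarke derivative. Its invariance
    under (y, t) |-> (y + t d, t) yields subadditivity in the direction, under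
    (y, t) |-> (y, a t) positive homogeneity, and along y = x the comparison
    with the one-sided derivative. *)
Local Notation base x := (filter_prod (nbhs x) (0 : R)^'+).

Lemma cvg_base (T : Type) (F : set_system T) {FF : Filter F}
    (y : T -> 'rV[R]_n) (t : T -> R) x :
  y z @[z --> F] --> x -> t z @[z --> F] --> (0 : R)^'+ ->
  (y z, t z) @[z --> F] --> base x.
Proof.
move=> yx t0; have := @cvg_pair _ _ _ F (nbhs x) (0 : R)^'+ _ _ _ y t yx t0.
exact.
Qed.

Lemma base_gt0 x : \forall yt \near base x, 0 < yt.2.
Proof. exact: (@cvg_snd _ _ (nbhs x) _ _ _ (nbhs_right_gt (0 : R))). Qed.

Lemma cvg_base_shift x d : (yt.1 + yt.2 *: d) @[yt --> base x] --> x.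
Proof.
rewrite -[X in _ --> X]addr0 -(scale0r d); apply: cvgD; first exact: cvg_fst.
apply: cvgZr_tmp; apply: cvg_trans cvg_snd _; exact: cvg_within.
Qed.

Lemma cvg_base_translate x d :
  (yt.1 + yt.2 *: d, yt.2) @[yt --> base x] --> base x.
Proof.
have := @cvg_base _ (base x) _ (fun yt => yt.1 + yt.2 *: d) snd x
  (@cvg_base_shift x d) cvg_snd.
exact.
Qed.

Lemma cvg_base_rescale x (a : R) : 0 < a ->
  (yt.1, a * yt.2) @[yt --> base x] --> base x.
Proof.
move=> a0; suff : a * t @[t --> (0 : R)^'+] --> (0 : R)^'+.
  move=> at0; have := @cvg_base _ (base x) _ fst (fun yt => a * yt.2) x
    cvg_fst (cvg_comp snd _ cvg_snd at0).
  exact.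
have : a * t @[t --> (0 : R)^'+] --> (0 : R).
  rewrite -[X in _ --> X](mulr0 a); apply: (@cvgMl_tmp _ _ (0 : R)^'+).
  exact: cvg_within.
move=> at0 A; rewrite /= => A0.
have {}A0 : \forall s \near (0 : R), 0 < s -> A s by [].
have := at0 _ A0; apply: filterS2 (nbhs_right_gt (0 : R)) => t t0; apply.
exact: mulr_gt0.
Qed.

Lemma cvg_base_ray x : (x, t) @[t --> (0 : R)^'+] --> base x.
Proof.
have := @cvg_base _ (0 : R)^'+ _ (cst x) id x (cvg_cst x) cvg_id.
exact.
Qed.

Lemma diff_quotient_bound g x d : locally_lipschitz_at g x ->
  exists K : R, \forall yt \near base x, `|diff_quotient g yt.1 d yt.2| <= K.
Proof.
case/locally_lipschitzP => K gK; exists (K * `|d|).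
have {}gK : \forall yt \near base x,
    `|g (yt.1 + yt.2 *: d) - g yt.1| <= K * `|yt.1 + yt.2 *: d - yt.1|.
  exact: (@cvg_pair _ _ _ (base x) (nbhs x) (nbhs x) _ _ _ _ _
    (@cvg_base_shift x d) cvg_fst _ gK).
apply: filterS2 (base_gt0 x) gK => -[y t] /= t0.
rewrite addrAC subrr add0r normrZ gtr0_norm // => yK.
rewrite /diff_quotient normf_div (gtr0_norm t0) ler_pdivrMr //.
by rewrite -mulrA (mulrC `|d|).
Qed.

Lemma clarke_dderiv_leP g x d (c : R) :
  (clarke_dderiv g x d <= c%:E)%E <->
  forall e, 0 < e -> \forall yt \near base x,
    diff_quotient g yt.1 d yt.2 <= c + e.
Proof. exact: limf_esup_leP. Qed.

(** The real value of the Clarke derivative; [clarkeE] shows that nothing is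
    lost by [fine] at a point of local Lipschitz continuity. *)
Definition clarke g x d : R := fine (clarke_dderiv g x d).

Lemma clarkeE g x d : locally_lipschitz_at g x ->
  clarke_dderiv g x d = (clarke g x d)%:E.
Proof.
case/(diff_quotient_bound d) => K gK; rewrite /clarke fineK // fin_real //.
apply/andP; split.
  apply: lt_le_trans (ltNyr (- K)) _; apply: limf_esup_ge.
  by apply: filterS gK => yt; rewrite ler_norml => /andP[].
apply: le_lt_trans (ltry K); apply/clarke_dderiv_leP => e e0.
by apply: filterS gK => yt /ler_normlW /le_trans; apply; rewrite lerDl ltW.
Qed.

Lemma clarke_leP g x d c : locally_lipschitz_at g x ->
  clarke g x d <= c <->
  forall e, 0 < e -> \forall yt \near base x,
    diff_quotient g yt.1 d yt.2 <= c + e.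
Proof.
by move=> gx; rewrite -lee_fin -clarkeE //; exact: clarke_dderiv_leP.
Qed.

(** The quotient in direction d + d' at y is the quotient in direction d at
    y + t d' plus the quotient in direction d' at y. *)
Lemma sublinear_clarke g x : locally_lipschitz_at g x -> sublinear (clarke g x).
Proof.
move=> gx; split=> [d d'|a d].
  apply/clarke_leP => // e e0.
  have e2 : 0 < e / 2 by rewrite divr_gt0.
  have := @cvg_base_translate x d' _ ((@clarke_leP g x d _ gx).1 (lexx _) _ e2).
  have := (@clarke_leP g x d' _ gx).1 (lexx _) _ e2.
  apply: filterS2 => -[y t] /= qd' qd; rewrite [e]splitr addrACA.
  apply: le_trans (lerD qd qd'); rewrite /diff_quotient -mulrDl.
  by rewrite addrA subrK scalerDr (addrC (t *: d)) addrA.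
rewrite le_eqVlt => /predU1P[<-|a0].
  rewrite scale0r mul0r; apply/clarke_leP => // e e0; apply: nearW => yt.
  by rewrite /diff_quotient scaler0 addr0 subrr mul0r add0r ltW.
apply/clarke_leP => // e e0.
have ea : 0 < e / a by rewrite divr_gt0.
have := @cvg_base_rescale x a a0 _ ((@clarke_leP g x d _ gx).1 (lexx _) _ ea).
apply: filterS2 (base_gt0 x) => -[y t] /= t0.
rewrite -(ler_pM2l a0) mulrDr [a * (e / a)]mulrC divfK ?gt_eqF //.
move/(le_trans _); apply; rewrite /diff_quotient scalerA (mulrC t).
by rewrite le_eqVlt; apply/orP; left; apply/eqP; field; rewrite !gt_eqF.
Qed.

Lemma clarke_subdiffP g x eta : locally_lipschitz_at g x ->
  clarke_subdiff g x eta <-> forall d, (eta *m d^T) 0 0 <= clarke g x d.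
Proof. by move=> gx; split=> h d; have := h d; rewrite clarkeE // lee_fin. Qed.

Lemma convex_clarke_subdiff g x : locally_lipschitz_at g x ->
  @convex_set R 'rV[R]_n (clarke_subdiff g x).
Proof.
move=> gx u v k; rewrite !inE.
move=> /(clarke_subdiffP _ gx) hu /(clarke_subdiffP _ gx) hv.
apply/clarke_subdiffP => // d; rewrite /conv /= mulmxDl [leLHS]mxE -!scalemxAl.
rewrite [X in X + _]mxE [X in _ + X]mxE.
have k0 : 0 <= k%:num by [].
have k1 : 0 <= 1 - k%:num by rewrite subr_ge0.
apply: le_trans (lerD (ler_wpM2l k0 (hu d)) (ler_wpM2l k1 (hv d))) _.
by rewrite -mulrDl addrC subrK mul1r.
Qed.

Lemma dderiv_le_clarke g x d : locally_lipschitz_at g x ->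
  cvg (diff_quotient g x d t @[t --> (0 : R)^'+]) ->
  dderiv g x d <= clarke g x d.
Proof.
move=> gx cv; apply/ler_addgt0Pr => e e0; apply: limr_le => //.
exact: (@cvg_base_ray x _ ((@clarke_leP g x d _ gx).1 (lexx _) _ e0)).
Qed.

End clarke_calculus.

(** * Clarke calculus of a finite maximum *)

Section max_rule.
Variables (R : realType) (n : nat) (I : finType) (i0 : I).
Variables (g : 'rV[R]_n -> R) (h : I -> 'rV[R]_n -> R) (x : 'rV[R]_n).
Hypothesis h_lip : forall i, locally_lipschitz_at (h i) x.
Hypothesis g_max : \forall y \near x,
  (forall i, h i y <= g y) /\ exists i, g y = h i y.
Hypothesis h_active : forall i, h i x = g x.

Lemma max_locally_lipschitz : locally_lipschitz_at g x.
Proof.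
pose K i : R := projT1 (cid ((locally_lipschitzP (h i) x).1 (h_lip i))).
pose M := \sum_i `|K i|.
apply/locally_lipschitzP; exists M.
have hK i : \forall y \near x & z \near x, `|h i y - h i z| <= K i * `|y - z|.
  by rewrite /K; case: cid.
have hKall : \forall y \near x & z \near x,
    forall i, `|h i y - h i z| <= K i * `|y - z|.
  exact: (@filter_forall _ _ _ (filter_prod (nbhs x) (nbhs x)) _ hK).
have gm2 : \forall y \near x & z \near x,
  ((forall i, h i y <= g y) /\ exists i, g y = h i y) /\
  ((forall i, h i z <= g z) /\ exists i, g z = h i z).
  by eexists (_, _); [split; exact: g_max|].
apply: filterS2 hKall gm2 => -[y z] /= hyz [[hy [i gy]] [hz [j gz]]].
have KM k : K k * `|y - z| <= M * `|y - z|.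
  rewrite ler_wpM2r // (le_trans (ler_norm _)) // /M (bigD1 k) //= lerDl.
  exact: sumr_ge0.
(* g y - g z is at most h i y - h i z when h i attains the maximum at y *)
rewrite ler_norml; apply/andP; split.
  have := hy j; have := hyz j; rewrite ler_norml => /andP[+ _].
  by have := KM j; rewrite gz; lra.
have := hz i; have := hyz i; rewrite ler_norml => /andP[_].
by have := KM i; rewrite gy; lra.
Qed.

Local Notation base x := (filter_prod (nbhs x) (0 : R)^'+).

(** The index i attaining the maximum at y + t d depends on (y, t), so the
    bounds on the quotients of all the h i are first made simultaneous. *)
Lemma clarke_max_le d (c : R) :
  (forall i, clarke (h i) x d <= c) -> clarke g x d <= c.
Proof.
move=> hc; apply/clarke_leP; first exact: max_locally_lipschitz.
move=> e e0.
have hq : \forall yt \near base x,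
    forall i, diff_quotient (h i) yt.1 d yt.2 <= c + e.
  apply: (@filter_forall _ _ _ (base x)) => i.
  by apply/clarke_leP: e e0.
have gy : \forall yt \near base x, forall i, h i yt.1 <= g yt.1.
  have gy : \forall y \near x, forall i, h i y <= g y.
    by apply: filterS g_max => y [].
  exact: (@cvg_fst _ _ (nbhs x) (0 : R)^'+ _ _ gy).
have gyt : \forall yt \near base x,
    exists i, g (yt.1 + yt.2 *: d) = h i (yt.1 + yt.2 *: d).
  have gy' : \forall y \near x, exists i, g y = h i y.
    by apply: filterS g_max => y [].
  exact: (@cvg_base_shift _ _ x d _ gy').
apply: filterS3 hq gy (filterI gyt (base_gt0 x)) => -[y t] /= hq gy [[i gi] t0].
apply: le_trans (hq i); rewrite /diff_quotient ler_pM2r ?invr_gt0 // gi.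
by rewrite lerD2l lerN2.
Qed.

Lemma clarke_max_attained d : exists i, clarke g x d <= clarke (h i) x d.
Proof.
exists [arg max_(i > i0) clarke (h i) x d]%O.
apply: clarke_max_le => i; case: arg_maxP => // j _; exact.
Qed.

Lemma clarke_subdiff_max_sub :
  clarke_subdiff g x `<=` conv_hull (\bigcup_i clarke_subdiff (h i) x).
Proof.
move=> eta /(clarke_subdiffP _ max_locally_lipschitz) eta_le.
have eta_max d : exists i, (eta *m d^T) 0 0 <= clarke (h i) x d.
  have [i gi] := clarke_max_attained d.
  by exists i; exact: le_trans (eta_le d) gi.
have [lam [xi [lam0 lam1 xi_le ->]]] :=
  mem_hull_of_le_max i0 (fun i => sublinear_clarke (h_lip i)) eta_max.
move=> C [cC subC]; apply: convex_combination => // i lami; apply: subC.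
by exists i => //; apply/clarke_subdiffP => // d; exact: xi_le.
Qed.

Section regular.
Hypothesis h_reg : forall i, subdiff_regular (h i) x.

Let dderiv_clarke i d : dderiv (h i) x d = clarke (h i) x d.
Proof. by have [_ _ e] := h_reg i; rewrite /clarke -e. Qed.

(** At the base point x the quotient of g is exactly the maximum of those of
    the h i. If these are within e of their limits, then so is their
    maximum. *)
Lemma max_dderiv d j : (forall i, clarke (h i) x d <= clarke (h j) x d) ->
  diff_quotient g x d t @[t --> (0 : R)^'+] --> clarke (h j) x d.
Proof.
move=> jmax; apply/cvgrPdist_le => e e0.
have hcvg i : \forall t \near (0 : R)^'+,
    `|clarke (h i) x d - diff_quotient (h i) x d t| <= e.
  have [_ cv _] := h_reg i; rewrite -dderiv_clarke.
  exact: (@cvgr_dist_le _ _ _ (0 : R)^'+ _ _ _ (cv d) _ e0).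
have hall : \forall t \near (0 : R)^'+,
    forall i, `|clarke (h i) x d - diff_quotient (h i) x d t| <= e.
  exact: filter_forall hcvg.
have gxt : \forall t \near (0 : R)^'+,
    (forall i, h i (x + t *: d) <= g (x + t *: d)) /\
    exists i, g (x + t *: d) = h i (x + t *: d).
  exact: (@cvg_base_ray _ _ x _ (@cvg_base_shift _ _ x d _ g_max)).
apply: filterS3 hall gxt (nbhs_right_gt (0 : R)) => t hall [hle [i gi]] t0.
have qge : diff_quotient (h j) x d t <= diff_quotient g x d t.
  by rewrite /diff_quotient ler_pM2r ?invr_gt0 // h_active lerD2r.
have qle : diff_quotient g x d t = diff_quotient (h i) x d t.
  by rewrite /diff_quotient h_active gi.
have := hall j; have := hall i; rewrite !ler_norml.
by move=> /andP[? _] /andP[_ ?]; have := jmax i; move: qge qle; lra.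
Qed.

(** With j maximizing h_j°(x; d): dderiv g = h_j° >= clarke g by the upper
    estimate, and dderiv g <= clarke g always. *)
Lemma clarke_max_regular d :
  [/\ cvg (diff_quotient g x d t @[t --> (0 : R)^'+]),
      dderiv g x d = clarke g x d &
      forall i, clarke (h i) x d <= clarke g x d].
Proof.
pose j := [arg max_(i > i0) clarke (h i) x d]%O.
have jmax i : clarke (h i) x d <= clarke (h j) x d.
  by rewrite /j; case: arg_maxP => // k _; exact.
have gcvg := max_dderiv jmax.
have cv : cvg (diff_quotient g x d t @[t --> (0 : R)^'+]).
  by apply/cvg_ex; exists (clarke (h j) x d).
have gj : dderiv g x d = clarke (h j) x d by exact: cvg_lim gcvg.
have gle := dderiv_le_clarke max_locally_lipschitz cv.
have E : dderiv g x d = clarke g x d.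
  by apply/eqP; rewrite eq_le gle gj clarke_max_le.
by split=> // i; rewrite -E gj.
Qed.

Lemma max_subdiff_regular : subdiff_regular g x.
Proof.
split=> [|d|d]; first exact: max_locally_lipschitz.
  by have [] := clarke_max_regular d.
have [_ -> _] := clarke_max_regular d.
by rewrite clarkeE //; exact: max_locally_lipschitz.
Qed.

Lemma clarke_subdiff_max :
  clarke_subdiff g x = conv_hull (\bigcup_i clarke_subdiff (h i) x).
Proof.
apply/seteqP; split; first exact: clarke_subdiff_max_sub.
apply: smallest_sub; first exact: convex_clarke_subdiff max_locally_lipschitz.
move=> eta [i _ /(clarke_subdiffP _ (h_lip i)) eta_le].
apply/(clarke_subdiffP _ max_locally_lipschitz) => d.
by have [_ _ gi] := clarke_max_regular d; exact: le_trans (gi i).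
Qed.

End regular.
End max_rule.

(** * Ordered values near the reference point *)

Section locally_max.
Variables (R : realType) (n m p q : nat).
Variables (zeta : 'I_p -> 'rV[R]_m) (xbar : 'rV[R]_n).
Variable f : 'rV[R]_n -> 'rV[R]_m -> R.
Hypothesis hflip : forall i, locally_lipschitz_at (fun x => f x (zeta i)) xbar.
Variables (k : 'I_q -> 'I_p) (j0 : 'I_q) (l : 'I_p).

Let c := f xbar (zeta (k j0)).
Let v (x : 'rV[R]_n) (i : 'I_p) : R := f x (zeta i).
Let A : {set 'I_p} := [set i | c < v xbar i]%SET.

Hypothesis hk : forall j, f xbar (zeta (k j)) = c.
Hypothesis hkall : forall i, f xbar (zeta i) = c -> exists j, k j = i.
Hypothesis hl : ordered_value f zeta l xbar = c.
Hypothesis hlmin : forall i, ordered_value f zeta i xbar = c -> (l <= i)%N.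

Let A_upper i j : i \in A -> j \notin A -> v xbar j < v xbar i.
Proof. by rewrite !inE -leNgt => ci jc; exact: le_lt_trans ci. Qed.

Let kA j : k j \notin A.
Proof. by rewrite inE /v hk ltxx. Qed.

(** At position #|A| the selection returns a maximum over ~: A, that is c, so
    l <= #|A|; at every earlier position it returns a value above c. *)
Lemma least_index_card : l = #|A| :> nat.
Proof.
have ltAp : (#|A| < p)%N.
  rewrite -[ltnRHS]card_ord; apply: proper_card; apply/properP.
  by split; [exact/fintype.subsetP|exists (k j0)].
have [oA omax] := order_index_card (i := Ordinal ltAp) A_upper erefl.
have leA : (l <= Ordinal ltAp)%N.
  apply: hlmin; apply/eqP; rewrite eq_le; apply/andP; split.
    by move: oA; rewrite inE -leNgt.
  exact: omax (kA j0).
apply/eqP; rewrite eqn_leq leA leqNgt; apply/negP.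
move=> /(order_index_upper A_upper).
by rewrite inE -[v xbar _]/(ordered_value f zeta l xbar) hl ltxx.
Qed.

Lemma near_value_lt i j : v xbar j < v xbar i ->
  \forall y \near xbar, v y j < v y i.
Proof.
move=> /midf_lt[lo hi]; set mid := (_ / _) in lo hi.
have vj : \forall y \near xbar, v y j < mid.
  exact: (@cvgr_lt _ _ (nbhs xbar) _ _ _ (locally_lipschitz_cvg (hflip j))).
have vi : \forall y \near xbar, mid < v y i.
  exact: (@cvgr_gt _ _ (nbhs xbar) _ _ _ (locally_lipschitz_cvg (hflip i))).
by apply: filterS2 vj vi => y; exact: lt_trans.
Qed.

(** Near xbar every strict inequality between two values at xbar persists. So A
    still dominates, which makes position l return a maximum over ~: A, and an
    index with value below c at xbar stays below k j0, hence is not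
    selected. *)
Lemma ordered_value_near_max : \forall y \near xbar,
  (forall j, f y (zeta (k j)) <= ordered_value f zeta l y) /\
  exists j, ordered_value f zeta l y = f y (zeta (k j)).
Proof.
have : \forall y \near xbar,
    forall ij : 'I_p * 'I_p, v xbar ij.2 < v xbar ij.1 -> v y ij.2 < v y ij.1.
  apply: (@filter_forall _ _ _ (nbhs xbar)) => -[i j] /=.
  have [ji|_] := boolP (v xbar j < v xbar i).
    by apply: filterS (near_value_lt ji).
  exact: (@nearW _ (nbhs xbar)).
apply: filterS => y vy.
have Ay i j : i \in A -> j \notin A -> v y j < v y i.
  by move=> iA jA; exact: (vy (i, j)) (A_upper iA jA).
have [oA omax] := order_index_card Ay least_index_card.
split=> [j|]; first exact: omax (kA j).
set i := order_index (v y) l in oA omax.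
have [|j ji] := @hkall i; last by exists j; rewrite ji.
apply/eqP; rewrite eq_le; apply/andP; split.
  by move: oA; rewrite inE -leNgt.
rewrite leNgt; apply/negP => ic.
have := vy (k j0, i) ic; rewrite /= ltNge => /negP; apply.
exact: omax (kA j0).
Qed.

End locally_max.

(* hkall: k_1, ..., k_q list all the indices at which f(xbar, .) takes the
   common value. *)
Theorem theorem5p6 (R : realType) (n m p q : nat)
    (zeta : 'I_p -> 'rV[R]_m) (X : set 'rV[R]_n) (xbar : 'rV[R]_n)
    (f : 'rV[R]_n -> 'rV[R]_m -> R)
    (hX : compact X) (hxbar : X xbar)
    (hf0 : forall x i, X x -> 0 <= f x (zeta i))
    (hflip : forall i, locally_lipschitz_at (fun x => f x (zeta i)) xbar)
    (hq : (0 < q)%N) (k : 'I_q -> 'I_p)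
    (hk : forall j j' : 'I_q, f xbar (zeta (k j)) = f xbar (zeta (k j')))
    (hkall : forall (i : 'I_p) (j : 'I_q),
      f xbar (zeta i) = f xbar (zeta (k j)) -> exists j' : 'I_q, k j' = i)
    (l : 'I_p)
    (hl : forall j : 'I_q,
      ordered_value f zeta l xbar = f xbar (zeta (k j)))
    (hlmin : forall i : 'I_p,
      (forall j : 'I_q, ordered_value f zeta i xbar = f xbar (zeta (k j))) ->
      (l <= i)%N) :
  let s_l := ordered_value f zeta l in
  let J_l := [set j : 'I_q | f xbar (zeta (k j)) = s_l xbar] in
  let C := conv_hull (\bigcup_(j in J_l)
             clarke_subdiff (fun x => f x (zeta (k j))) xbar) in
  clarke_subdiff s_l xbar `<=` C /\
  ((forall j : 'I_q, subdiff_regular (fun x => f x (zeta (k j))) xbar) ->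
   subdiff_regular s_l xbar /\ clarke_subdiff s_l xbar = C).
Proof.
move=> s_l J_l C; pose j0 : 'I_q := Ordinal hq.
have g_max := ordered_value_near_max hflip (fun j => hk j j0)
  (fun i => @hkall i j0) (hl j0)
  (fun i e => hlmin i (fun j => etrans e (hk j0 j))).
have J_lT : J_l = setT by apply/seteqP; split=> // j _; exact/esym/hl.
have h_lip j := hflip (k j).
rewrite /C J_lT; split; first exact: (clarke_subdiff_max_sub j0 h_lip g_max).
have h_active j : f xbar (zeta (k j)) = s_l xbar by exact/esym/hl.
move=> h_reg; split.
  exact: (max_subdiff_regular j0 h_lip g_max h_active h_reg).
exact: (clarke_subdiff_max j0 h_lip g_max h_active h_reg).
Qed.
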